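(* Let $\bigl(\mathbf{X}^h(\cdot,t),\kappa^h(\cdot,t)\bigr)$ be the solution of the following semi-discretization: given the initial polygonal curve $\Gamma^h(0)=\mathbf{X}^h(\cdot,0)\in\mathbb{X}^h$ with $\mathbf{X}^h(\rho_j,0)=\mathbf{X}_0(s_j)$, $s_j=jL_0/N$, $0\le j\le N$, and $x_c^l(0)=x_0(0)<x_c^r(0)=x_0(L_0)$, for $t>0$ find $\Gamma^h(t)=\mathbf{X}^h(\cdot,t)=(x^h(\cdot,t),y^h(\cdot,t))^T\in\mathbb{X}^h$ and $\kappa^h(\cdot,t)\in\mathbb{K}^h$ such that $$\bigl(\mathbf{n}^h\cdot\partial_t\mathbf{X}^h,\psi^h\bigr)^h_{\Gamma^h(t)}+\bigl(\partial_s\kappa^h,\partial_s\psi^h\bigr)_{\Gamma^h(t)}=0,\qquad\forall\,\psi^h\in\mathbb{K}^h,$$ $$\bigl(\kappa^h,\mathbf{n}^h\cdot\boldsymbol{\omega}^h\bigr)^h_{\Gamma^h(t)}-\bigl(\partial_s\mathbf{X}^h,\partial_s\boldsymbol{\omega}^h\bigr)_{\Gamma^h(t)}-\frac1\eta\Bigl[\frac{dx_c^l(t)}{dt}\,\omega^h_1(0)+\frac{dx_c^r(t)}{dt}\,\omega^h_1(1)\Bigr]+\sigma\bigl[\omega^h_1(1)-\omega^h_1(0)\bigr]=0,\qquad\forall\,\boldsymbol{\omega}^h=(\omega^h_1,\omega^h_2)^T\in\mathbb{X}^h,$$ where $x_c^l(t)=x^h(\rho_0,t)$ and $x_c^r(t)=x^h(\rho_N,t)$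 are assumed to satisfy $x_c^l(t)\le x_c^r(t)$. Then the total area is conserved, i.e., $$A^h(t)\equiv A^h(0)=\frac12\sum_{j=1}^N\bigl[x_0(s_j)-x_0(s_{j-1})\bigr]\bigl[y_0(s_j)+y_0(s_{j-1})\bigr]>0,\qquad t\ge0,$$ and the total free energy is decreasing during the evolution, i.e., $$W^h(t)\le W^h(t')\le W^h(0)=\sum_{j=1}^N|\mathbf{h}_j(0)|-\sigma\bigl(x_c^r(0)-x_c^l(0)\bigr),\qquad t\ge t'\ge0.$$
   Context: $\mathbf{I}=[0,1]$; $\sigma\in(-1,1)$ and $\eta>0$ are constants; $N\ge1$ is an integer, $h=1/N$, $\rho_j=jh$ and $I_j=[\rho_{j-1},\rho_j]$. $\mathbb{K}^h$ is the space of continuous functions on $\mathbf{I}$ that are polynomials of degree at most $1$ on each $I_j$; $\mathbb{K}^h_0=\{u\in\mathbb{K}^h:u(0)=u(1)=0\}$; $\mathbb{X}^h=\mathbb{K}^h\times\mathbb{K}^h_0$. The initial curve is $\mathbf{X}_0(s)=(x_0(s),y_0(s))^T$, $0\le s\le L_0$, parameterized by arc length with total length $L_0$, with $y_0(0)=y_0(L_0)=0$ and $x_0(0)<x_0(L_0)$. Write $\mathbf{h}_j(t)=\mathbf{X}^h(\rho_j,t)-\mathbf{X}^h(\rho_{j-1},t)$; it is always assumed that $\min_{1\le j\le N}|\mathbf{h}_j(t)|>0$ for all $t\ge0$. On $I_j$ the unit tangent is $\boldsymbol{\tau}^h_j=\mathbf{h}_j/|\mathbf{h}_j|$ and the unit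 normal is $\mathbf{n}^h_j=-(\boldsymbol{\tau}^h_j)^\perp$, where $(\cdot)^\perp$ is clockwise rotation by $90$ degrees (so $(a,b)^T\mapsto(b,-a)^T$); $\mathbf{n}^h$ is the piecewise constant function with value $\mathbf{n}^h_j$ on $I_j$. On $I_j$, $\partial_s=\frac{h}{|\mathbf{h}_j|}\partial_\rho$ (derivative with respect to arc length of $\Gamma^h(t)$). $(u,v)_{\Gamma^h(t)}$ denotes the $L^2$ inner product along $\Gamma^h(t)$ with respect to arc length (for scalar or vector functions), and the mass-lumped inner product is $$(u,v)^h_{\Gamma^h(t)}=\frac12\sum_{j=1}^N|\mathbf{h}_j|\bigl[(u\cdot v)(\rho_j^-)+(u\cdot v)(\rho_{j-1}^+)\bigr],$$ with one-sided limits at the nodes. With $\mathbf{X}^h(\rho_j,t)=(x_j(t),y_j(t))^T$, the discrete area and energy are $$A^h(t)=\frac12\sum_{j=1}^N(x_j-x_{j-1})(y_j+y_{j-1}),\qquad W^h(t)=\sum_{j=1}^N|\mathbf{h}_j(t)|-\sigma\bigl[x_c^r(t)-x_c^l(t)\bigr].$$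
   Formalization: The claim that the area is positive is proved only under the added assumption A^h(0) > 0, since nothing stated excludes an initial curve below the substrate with negative area (e.g. a mirrored stationary triangle with N = 2); all other claims are unconditional. *)

(* Defs.v *)
From HB Require Import structures.
From mathcomp Require Import all_boot all_order all_algebra.
From mathcomp Require Import all_classical all_reals all_analysis.

Set Implicit Arguments.
Unset Strict Implicit.
Unset Printing Implicit Defensive.

Import Order.TTheory GRing.Theory Num.Theory.
Import numFieldNormedType.Exports.

Local Open Scope classical_set_scope.
Local Open Scope ring_scope.

Section Plane.
Context {R : realType}.

Definition dot (p q : R * R) : R := p.1 * q.1 + p.2 * q.2.

(* The library norm on [R * R] is the max norm, hence this one. *)
Definition enorm (p : R * R) : R := Num.sqrt (dot p p).

(* Clockwise rotation by 90 degrees. *)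
Definition perp (p : R * R) : R * R := (p.2, - p.1).

(* Length of the polygon inscribed in [c] at the points [a :: s]; same
   conventions as [variation] and [total_variation] of realfun. *)
Definition polygon_length (c : R -> R * R) (a b : R) (s : seq R) : R :=
  \sum_(i < size s) enorm (c (nth b (a :: s) i.+1) - c (nth b (a :: s) i)).

Definition curve_length (c : R -> R * R) (a b : R) : \bar R :=
  ereal_sup [set (polygon_length c a b s)%:E | s in itv_partition a b].

Definition arclength_param (c : R -> R * R) (L : R) : Prop :=
  0 <= L /\
  forall a b : R, 0 <= a -> a <= b -> b <= L -> curve_length c a b = (b - a)%:E.

End Plane.

(* Grid functions and polygonal curves are total functions of rho : R; only
   their values on [0, 1] matter. *)
Section Discretization.
Context {R : realType}.
Variable N : nat.

Definition mesh : R := N%:R^-1.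

Definition rho (j : nat) : R := j%:R * mesh.

Definition in_Kh (u : R -> R) : Prop :=
  {within `[0, 1], continuous u} /\
  forall j, (1 <= j <= N)%N -> exists p : {poly R},
    (size p <= 2)%N /\ forall r : R, r \in `[rho j.-1, rho j] -> u r = p.[r].

Definition in_Kh0 (u : R -> R) : Prop := [/\ in_Kh u, u 0 = 0 & u 1 = 0].

Definition in_Xh (w : R -> R * R) : Prop :=
  in_Kh (fun r => (w r).1) /\ in_Kh0 (fun r => (w r).2).

(* The j with rho_(j-1) <= r < rho_j. Everything defined through [cell] below
   is used only inside integrals and one-sided limits, so the value chosen at
   the nodes is immaterial. *)
Definition cell (r : R) : nat := (Num.truncn (r / mesh)).+1.

Section Curve.
Variable X : R -> R * R.

Definition hvec (j : nat) : R * R := X (rho j) - X (rho j.-1).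

Definition tangent (j : nat) : R * R := (enorm (hvec j))^-1 *: hvec j.

Definition normal (r : R) : R * R := - perp (tangent (cell r)).

Definition ds (u : R -> R) (r : R) : R :=
  mesh / enorm (hvec (cell r)) * derive1 u r.

Definition dsv (w : R -> R * R) (r : R) : R * R :=
  (ds (fun q => (w q).1) r, ds (fun q => (w q).2) r).

(* On I_j the arc length element is |h_j| / h d rho. *)
Definition arc_integral (f : R -> R) : R :=
  \sum_(1 <= j < N.+1) \int[lebesgue_measure]_(r in `[rho j.-1, rho j])
     (f r * (enorm (hvec j) / mesh)).

Definition inner (u v : R -> R) : R := arc_integral (fun r => u r * v r).

Definition innerv (u v : R -> R * R) : R :=
  arc_integral (fun r => dot (u r) (v r)).

Definition lumped (u v : R -> R) : R :=
  2^-1 * \sum_(1 <= j < N.+1) enorm (hvec j) *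
    (lim ((u r * v r) @[r --> (rho j)^'-]) +
     lim ((u r * v r) @[r --> (rho j.-1)^'+])).

Definition area : R :=
  2^-1 * \sum_(1 <= j < N.+1)
    ((X (rho j)).1 - (X (rho j.-1)).1) * ((X (rho j)).2 + (X (rho j.-1)).2).

Definition energy (sigma : R) : R :=
  \sum_(1 <= j < N.+1) enorm (hvec j)
    - sigma * ((X (rho N)).1 - (X (rho 0)).1).

End Curve.

(* [X t r] is X^h(r, t) and [kappa t r] is kappa^h(r, t). *)
Definition dt (X : R -> R -> R * R) (t r : R) : R * R :=
  (derive1 (fun s : R => (X s r).1) t, derive1 (fun s : R => (X s r).2) t).

Definition xcl (X : R -> R -> R * R) (t : R) : R := (X t (rho 0)).1.
Definition xcr (X : R -> R -> R * R) (t : R) : R := (X t (rho N)).1.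

Record semidiscrete_solution (sigma eta L0 : R) (X0 : R -> R * R)
    (X : R -> R -> R * R) (kappa : R -> R -> R) : Prop := {
  sol_init : forall j, (j <= N)%N -> X 0 (rho j) = X0 (j%:R * L0 / N%:R);
  sol_Xh : forall t : R, 0 <= t -> in_Xh (X t);
  sol_Kh : forall t : R, 0 < t -> in_Kh (kappa t);
  sol_continuous : forall r : R, r \in `[0, 1] ->
    {within `[0, +oo[, continuous (fun t : R => (X t r).1)} /\
    {within `[0, +oo[, continuous (fun t : R => (X t r).2)};
  sol_derivable : forall r t : R, r \in `[0, 1] -> 0 < t ->
    derivable (fun s : R => (X s r).1) t 1 /\ derivable (fun s : R => (X s r).2) t 1;
  sol_motion : forall t : R, 0 < t -> forall psi, in_Kh psi ->
    lumped (X t) (fun r => dot (normal (X t) r) (dt X t r)) psi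
    + inner (X t) (ds (X t) (kappa t)) (ds (X t) psi) = 0;
  sol_curvature : forall t : R, 0 < t -> forall omega, in_Xh omega ->
    lumped (X t) (kappa t) (fun r => dot (normal (X t) r) (omega r))
    - innerv (X t) (dsv (X t) (X t)) (dsv (X t) omega)
    - 1 / eta * (derive1 (xcl X) t * (omega 0).1 + derive1 (xcr X) t * (omega 1).1)
    + sigma * ((omega 1).1 - (omega 0).1) = 0
}.

End Discretization.

(* Main.v *)
Require Import Defs.
From HB Require Import structures.
From mathcomp Require Import all_boot all_order all_algebra.
From mathcomp Require Import all_classical all_reals all_analysis.
From mathcomp Require Import ring lra.

Set Implicit Arguments.
Unset Strict Implicit.
Unset Printing Implicit Defensive.

Import Order.TTheory GRing.Theory Num.Theory.
Import numFieldNormedType.Exports.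

Local Open Scope classical_set_scope.
Local Open Scope ring_scope.

(** Both claims follow by testing the scheme with functions built from the
solution itself, after which only calculus in [t] remains.

Area.  Take [psi = 1] in the equation of motion: the stiffness term vanishes,
and the lumped product of the normal velocity with [1] is zero.  Since
[|h_j| n_j = (- (y_j - y_{j-1}), x_j - x_{j-1})], this product is
[1/2 \sum_j ((x_j - x_{j-1}) (y'_j + y'_{j-1}) - (y_j - y_{j-1}) (x'_j + x'_{j-1}))]
([lumped_normal_velocity]).  It differs from the derivative of the area by the
telescoping sum of [x'_j y_j - x'_{j-1} y_{j-1}], that is by
[x'_N y_N - x'_0 y_0], and this is zero because the contact points stay on the
line [y = 0] ([area_derive0]).

Energy.  Take [psi = kappa] in the equation of motion and [omega = dX/dt] in
the curvature equation, and subtract.  The two lumped products are the same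
number and cancel, which leaves
[(d_s X, d_s dX/dt) - sigma (x'_r - x'_l)
   = - (d_s kappa, d_s kappa) - 1/eta (x'_l^2 + x'_r^2) <= 0]
([dissipation]).  On each cell [d_s X] is the unit tangent and the derivative
of [dX/dt] along the edge is [h'_j / |h_j|], so the integral on the left is
[\sum_j h_j . h'_j / |h_j|], the derivative of the perimeter ([innerv_dsv],
[is_derive_energy]).  The left-hand side is therefore the derivative of the
energy.

The choice [omega = dX/dt] is admissible only if the velocity is again a finite
element function.  On a cell, [X] is at every time the linear interpolant of
its two nodal values, with weights independent of time, hence so is its time
derivative ([dt_lerp]); and a function that interpolates its nodal values
linearly on every cell is a finite element function ([lerp_Kh]).  The latter
includes continuity across the nodes, obtained by writing the function as a
finite sum of hat functions.

The identities hold for [t > 0], where the scheme holds; area and energy are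
continuous up to [t = 0], so the signs of their derivatives give monotonicity
from [t = 0] on. *)

(** * The finite element space on the uniform grid *)

Section FiniteElements.
Context {R : realType}.
Variable N : nat.
Hypothesis N_gt0 : (0 < N)%N.

Local Notation h := (@mesh R N).
Local Notation rho := (@rho R N).

Lemma mesh_gt0 : 0 < h.
Proof. by rewrite invr_gt0 ltr0n. Qed.

Lemma rho0 : rho 0 = 0.
Proof. by rewrite /Defs.rho mul0r. Qed.

Lemma rhoN : rho N = 1.
Proof. by rewrite /Defs.rho mulfV// pnatr_eq0 -lt0n. Qed.

Lemma rho_pred j : (0 < j)%N -> rho j = rho j.-1 + h.
Proof. by case: j => // j _; rewrite /Defs.rho/= -natr1 mulrDl mul1r. Qed.

Lemma rho_lt j : (0 < j)%N -> rho j.-1 < rho j.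
Proof. by move=> j0; rewrite (rho_pred j0) ltrDl mesh_gt0. Qed.

Lemma le_rho i j : (i <= j)%N -> rho i <= rho j.
Proof. by move=> ij; rewrite ler_pM2r ?mesh_gt0// ler_nat. Qed.

Lemma rho_in01 j : (j <= N)%N -> rho j \in `[0, 1].
Proof. by move=> jN; rewrite in_itv/= -{1}rho0 -rhoN !le_rho. Qed.

Lemma cell_cover r : r \in `[0, 1] ->
  exists2 j, (1 <= j <= N)%N & r \in `[rho j.-1, rho j].
Proof.
rewrite in_itv/= => /andP[r0 r1].
have: exists j, r <= rho j by exists N; rewrite rhoN.
case/ex_minnP => -[|j] rj jmin.
  exists 1%N => //; rewrite in_itv/= rho0 r0/=.
  by rewrite (le_trans rj)// le_rho.
exists j.+1; first by rewrite /= jmin// rhoN.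
rewrite in_itv/= rj andbT leNgt; apply/negP => /ltW /jmin.
by rewrite ltnn.
Qed.

Lemma cell_itv j r : (0 < j)%N -> r \in `]rho j.-1, rho j[ -> cell N r = j.
Proof.
case: j => // j _; rewrite in_itv/= => /andP[jr rj].
rewrite /cell; congr S; apply/Num.Theory.truncn_def.
by rewrite ler_pdivlMr ?ltr_pdivrMr ?mesh_gt0// (ltW jr).
Qed.

Definition lerp (c : nat -> R) (j : nat) (r : R) : R :=
  c j.-1 + (r - rho j.-1) / h * (c j - c j.-1).

Lemma lerp_l c j : lerp c j (rho j.-1) = c j.-1.
Proof. by rewrite /lerp subrr mul0r mul0r addr0. Qed.

Lemma lerp_r c j : (0 < j)%N -> lerp c j (rho j) = c j.
Proof.
move=> j0; rewrite /lerp {1}(rho_pred j0) addrAC subrr add0r mulfV ?mul1r ?subrKC//.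
by rewrite gt_eqF// mesh_gt0.
Qed.

Lemma is_derive_lerp c j (r : R) :
  is_derive r 1 (lerp c j) ((c j - c j.-1) / h).
Proof.
pose p : {poly R} := (c j.-1)%:P + ((c j - c j.-1) / h) *: ('X - (rho j.-1)%:P).
have -> : lerp c j = horner p.
  by apply/funext => x; rewrite /lerp !hornerE; ring.
apply: is_derive_eq.
by rewrite derivD derivZ derivB derivC derivX derivC subr0 add0r hornerZ hornerC mulr1.
Qed.

Lemma lerp_continuous c j : continuous (lerp c j).
Proof.
move=> r; apply/differentiable_continuous/derivable1_diffP.
by case: (is_derive_lerp c j r).
Qed.

(** A polynomial of degree at most one is determined by its values at the two
ends of the cell, so that a finite element function is known from its nodal
values. *)
Lemma Kh_lerp (u : R -> R) : in_Kh N u ->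
  forall j, (1 <= j <= N)%N -> forall r, r \in `[rho j.-1, rho j] ->
    u r = lerp (u \o rho) j r.
Proof.
move=> [_ up] j jN r rj; have [p [sp pE]] := up j jN.
have j0 : (0 < j)%N by case/andP: jN.
have pl x : p.[x] = p`_0 + p`_1 * x.
  by rewrite (horner_coef_wide _ sp) !big_ord_recl big_ord0/= expr0 expr1 mulr1 addr0.
have lej := ltW (rho_lt j0).
rewrite /lerp/= !pE ?in_itv/= ?lexx ?lej// !pl (rho_pred j0).
have := mesh_gt0 => /lt0r_neq0 h0; by field.
Qed.

(** The nodal basis functions, extended by zero to the whole line: being
continuous everywhere, they make the continuity of an interpolant across the
nodes immediate. *)
Definition hat (j : nat) (r : R) : R := Num.max 0 (1 - `|r / h - j%:R|).

Definition interp (c : nat -> R) (r : R) : R := \sum_(j < N.+1) c j * hat j r.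

Lemma hat_continuous j : continuous (hat j).
Proof.
have tentC : continuous (fun r : R => 1 - `|r / h - j%:R|).
  move=> r; apply: cvgB; first exact: cvg_cst.
  apply: cvg_norm; apply: cvgB; last exact: cvg_cst.
  exact: mulrr_continuous.
move=> r; apply: (@continuous_max R R (fun=> 0) (fun r => 1 - `|r / h - j%:R|) r).
  exact: cst_continuous.
exact: tentC.
Qed.

Lemma interp_continuous c : continuous (interp c).
Proof.
apply: continuous_big => [|i _ r]; first exact: add_continuous.
apply: continuousM; [exact: cst_continuous|exact: hat_continuous].
Qed.

(** Only the two hats centred at the ends of the cell are nonzero on it, and
their values there are the two barycentric weights. *)
Lemma interp_lerp c j r : (1 <= j <= N)%N -> r \in `[rho j.-1, rho j] ->
  interp c r = lerp c j r.
Proof.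
case: j => // j /= jN; rewrite in_itv/= => /andP[jr rj].
have h0 := mesh_gt0.
(* The barycentric coordinate of [r] in the cell. *)
pose th := (r - rho j) / h.
have th0 : 0 <= th by rewrite divr_ge0// ?subr_ge0// ltW.
have th1 : th <= 1.
  by rewrite ler_pdivrMr// mul1r lerBlDl -(@rho_pred j.+1).
have rE : r / h = j%:R + th.
  by rewrite /th /Defs.rho mulrBl mulfK ?gt_eqF// subrKC.
rewrite /interp (bigD1 (Ordinal (ltn_trans jN (ltnSn _))))//=.
rewrite (bigD1 (Ordinal (jN : (j.+1 < N.+1)%N)))/=; last first.
  by apply/eqP => /(congr1 val)/= /eqP; rewrite gtn_eqF.
rewrite big1 ?addr0 => [|i /andP[ij ij1]].
  rewrite /hat rE /lerp/= -/th -natr1.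
  rewrite (_ : j%:R + th - j%:R = th); last by ring.
  rewrite (_ : j%:R + th - (j%:R + 1) = th - 1); last by ring.
  rewrite ger0_norm// ler0_norm ?subr_le0// !max_r; [by ring|lra|lra].
rewrite /hat rE max_l ?mulr0// subr_le0.
have [ltij|leji] := ltnP i j.
  have : i%:R + 1 <= j%:R :> R by rewrite natr1 ler_nat.
  by rewrite ler_normr => ?; apply/orP; left; lra.
have : j%:R + 2 <= i%:R :> R.
  rewrite -natrD ler_nat addn2 ltn_neqAle; apply/andP; split.
    by apply: contra ij1 => /eqP ji; apply/eqP/val_inj.
  rewrite ltn_neqAle leji andbT.
  by apply: contra ij => /eqP ji; apply/eqP/val_inj.
by rewrite ler_normr => ?; apply/orP; right; lra.
Qed.

(** The criterion by which the velocity is recognized as a finite element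
function: on the unit interval [u] equals the interpolant of its nodal values,
which is continuous as a sum of hats. *)
Lemma lerp_Kh (u : R -> R) :
  (forall j, (1 <= j <= N)%N -> forall r, r \in `[rho j.-1, rho j] ->
    u r = lerp (u \o rho) j r) -> in_Kh N u.
Proof.
move=> uE; split; last first.
  move=> j jN; pose c := u \o rho.
  exists (('X - (rho j.-1)%:P) * ((c j - c j.-1) / h)%:P + (c j.-1)%:P); split.
    rewrite (leq_trans (size_polyD _ _))// geq_max; apply/andP; split.
      by rewrite (leq_trans (size_polyMleq _ _))// size_XsubC/= size_polyC; case: eqP.
    by rewrite size_polyC; case: eqP.
  by move=> r rj; rewrite (uE j jN r rj) hornerD hornerM hornerXsubC !hornerC
    /lerp -/c; ring.
apply: (@subspace_eq_continuous _ _ _ (interp (u \o rho))).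
  move=> r; rewrite inE/= => /cell_cover[j jN rj].
  by rewrite (interp_lerp _ jN rj); apply/esym/uE.
exact/continuous_subspaceT/interp_continuous.
Qed.

Lemma Kh_cst (a : R) : in_Kh N (fun=> a).
Proof.
by apply: lerp_Kh => j _ r _; rewrite /lerp/= subrr mulr0 addr0.
Qed.

(** The one-sided limits see only the open cells, so the normal and the time
derivative may be replaced there by any continuous expression. *)
Lemma lumpedE (X : R -> R * R) (u v : R -> R) (F : nat -> R -> R) :
  (forall j, (1 <= j <= N)%N -> continuous (F j)) ->
  (forall j, (1 <= j <= N)%N -> forall r, r \in `]rho j.-1, rho j[ ->
    u r * v r = F j r) ->
  lumped N X u v = 2^-1 * \sum_(1 <= j < N.+1)
    enorm (hvec N X j) * (F j (rho j) + F j (rho j.-1)).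
Proof.
move=> cF uvF; congr (_ * _).
rewrite !big_nat; apply: eq_bigr => j; rewrite ltnS => jN.
have j0 : (0 < j)%N by case/andP: jN.
have lej := rho_lt j0.
congr (_ * (_ + _)); apply: cvg_lim => //.
- have : F j r @[r --> (rho j)^'-] --> F j (rho j).
    exact/cvg_at_left_filter/cF.
  apply: cvg_trans; apply: near_eq_cvg; near=> r.
  apply/esym/uvF => //; rewrite in_itv/=; apply/andP; split.
    by near: r; exact: nbhs_left_gt.
  by near: r; exact: nbhs_left_lt.
- have : F j r @[r --> (rho j.-1)^'+] --> F j (rho j.-1).
    exact/cvg_at_right_filter/cF.
  apply: cvg_trans; apply: near_eq_cvg; near=> r.
  apply/esym/uvF => //; rewrite in_itv/=; apply/andP; split.
    by near: r; exact: nbhs_right_gt.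
  by near: r; exact: nbhs_right_lt.
Unshelve. all: by end_near. Qed.

Lemma derive1_Kh (u : R -> R) : in_Kh N u ->
  forall j, (1 <= j <= N)%N -> forall r, r \in `]rho j.-1, rho j[ ->
    derive1 u r = (u (rho j) - u (rho j.-1)) / h.
Proof.
move=> uK j jN r rj.
have du := is_derive_lerp (u \o rho) j r.
rewrite derive1E (_ : 'D_1 u r = 'D_1 (lerp (u \o rho) j) r); first exact: derive_val.
apply: near_eq_derive; near=> x; apply: Kh_lerp => //.
apply: subset_itv_oo_cc.
near: x; exact: near_in_itvoo.
Unshelve. all: by end_near. Qed.

(** The integrands of the scheme are constant inside a cell but not necessarily
at its ends: at the right end [cell] is already the next index, and a piecewise
linear function need not be differentiable at a node. *)
Lemma Rintegral_oo_cst (f : R -> R) (a b c : R) : a < b ->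
  (forall r, r \in `]a, b[ -> f r = c) ->
  \int[lebesgue_measure]_(r in `[a, b]) f r = c * (b - a).
Proof.
move=> ab fc.
have mf : measurable_fun `]a, b[ f.
  apply: (@eq_measurable_fun _ _ _ _ _ (fun=> c)); last exact: measurable_cst.
  by move=> x; rewrite inE/= => /fc.
have -> : \int[lebesgue_measure]_(r in `[a, b]) f r =
          \int[lebesgue_measure]_(r in `[a, b]) c.
  by rewrite /Rintegral (@eq_integral_itv_bounded _ _ _ (fun=> c)).
rewrite Rintegral_cst//= lebesgue_measure_itv/= lte_fin ab.
by rewrite -EFinD.
Qed.

(** On a cell the integrand is
[(mesh / |h_j|)^2 (h_j / mesh) . (w_j - w_{j-1}) / mesh], against the length
element [|h_j| / mesh] on an interval of length [mesh].  For [w = dX/dt] the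
result is the derivative of the perimeter. *)
Lemma innerv_dsv (X w : R -> R * R) :
  (forall j, (1 <= j <= N)%N -> 0 < enorm (hvec N X j)) ->
  in_Xh N X -> in_Xh N w ->
  innerv N X (dsv N X X) (dsv N X w) =
  \sum_(1 <= j < N.+1) dot (hvec N X j) (hvec N w j) / enorm (hvec N X j).
Proof.
move=> X0 [X1 [X2 _ _]] [w1 [w2 _ _]].
rewrite /innerv /arc_integral !big_nat; apply: eq_bigr => j; rewrite ltnS => jN.
have j0 : (0 < j)%N by case/andP: jN.
have e0 := X0 j jN.
have h0 := mesh_gt0.
rewrite (@Rintegral_oo_cst _ _ _ (dot (hvec N X j) (hvec N w j) /
   enorm (hvec N X j) / h)) ?rho_lt//.
  by rewrite (rho_pred j0) addrAC subrr add0r divfK// gt_eqF.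
move=> r rj; rewrite /dsv /ds /dot/= (cell_itv j0 rj).
rewrite !(derive1_Kh _ jN rj)//.
move: (lt0r_neq0 h0) (lt0r_neq0 e0).
move: (enorm _) => e h00 e00; rewrite /hvec/=.
by field; rewrite e00 h00.
Qed.

Lemma inner_ge0 (X : R -> R * R) (u : R -> R) : 0 <= inner N X u u.
Proof.
rewrite /inner /arc_integral sumr_ge0// => j _.
apply: Rintegral_ge0 => r _.
rewrite mulr_ge0 ?divr_ge0 ?sqrtr_ge0 ?(ltW mesh_gt0)//.
by rewrite -expr2 sqr_ge0.
Qed.

Lemma lumpedC (X : R -> R * R) (u v : R -> R) : lumped N X u v = lumped N X v u.
Proof.
rewrite /lumped; congr (_ * _); apply: eq_bigr => j _.
by under [fun r => u r * v r]eq_fun do rewrite mulrC.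
Qed.

End FiniteElements.

(** * Derivatives and continuity of sums and lengths *)

Section Calculus.
Context {R : realType}.

Lemma is_derive1M (f g : R -> R) (x df dg : R) :
  is_derive x 1 f df -> is_derive x 1 g dg ->
  is_derive x 1 (fun s => f s * g s) (f x * dg + g x * df).
Proof. by move=> Df Dg; apply: is_deriveM. Qed.

Lemma is_derive1D (f g : R -> R) (x df dg : R) :
  is_derive x 1 f df -> is_derive x 1 g dg ->
  is_derive x 1 (fun s => f s + g s) (df + dg).
Proof. by move=> Df Dg; apply: is_deriveD. Qed.

Lemma is_derive1B (f g : R -> R) (x df dg : R) :
  is_derive x 1 f df -> is_derive x 1 g dg ->
  is_derive x 1 (fun s => f s - g s) (df - dg).
Proof. by move=> Df Dg; apply: is_deriveB. Qed.

Lemma is_derive1Z (c : R) (f : R -> R) (x df : R) :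
  is_derive x 1 f df -> is_derive x 1 (fun s => c * f s) (c * df).
Proof. by move=> Df; apply: is_deriveZ. Qed.

Lemma is_derive1_sum (m n : nat) (f : nat -> R -> R) (df : nat -> R) (x : R) :
  (forall j, (m <= j < n)%N -> is_derive x 1 (f j) (df j)) ->
  is_derive x 1 (fun s => \sum_(m <= j < n) f j s) (\sum_(m <= j < n) df j).
Proof.
elim: n => [|n IH] Df.
  under eq_fun do rewrite big_geq//.
  by rewrite big_geq//; exact: is_derive_cst.
have [mn|nm] := leqP m n; last first.
  under eq_fun do rewrite big_geq//.
  by rewrite big_geq//; exact: is_derive_cst.
under eq_fun do rewrite big_nat_recr//=.
rewrite big_nat_recr//=; apply: is_derive1D.
  by apply: IH => j /andP[mj jn]; apply: Df; rewrite mj ltnS ltnW.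
by apply: Df; rewrite mn ltnSn.
Qed.

Lemma is_derive_enorm (p : R -> R * R) (x : R) (dp : R * R) :
  is_derive x 1 (fun s => (p s).1) dp.1 ->
  is_derive x 1 (fun s => (p s).2) dp.2 ->
  0 < enorm (p x) ->
  is_derive x 1 (fun s => enorm (p s)) (dot (p x) dp / enorm (p x)).
Proof.
move=> D1 D2 p0.
have dp0 : 0 < dot (p x) (p x) by rewrite -sqrtr_gt0.
have Dd := is_derive1D (is_derive1M D1 D1) (is_derive1M D2 D2).
have Ds := @is_derive1_comp R Num.sqrt (fun s => dot (p s) (p s)) x _ _
  (is_derive1_sqrt dp0) Dd.
rewrite (_ : _ / _ = (2 * enorm (p x))^-1 * ((p x).1 * dp.1 + (p x).1 * dp.1 +
  ((p x).2 * dp.2 + (p x).2 * dp.2))); first exact: Ds.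
by rewrite /dot; move: (lt0r_neq0 p0) => e0; field.
Qed.

Lemma within_continuous_sum (A : set R) (m n : nat) (f : nat -> R -> R) :
  (forall j, (m <= j < n)%N -> {within A, continuous (f j)}) ->
  {within A, continuous (fun s => \sum_(m <= j < n) f j s)}.
Proof.
move=> cf; have -> : (fun s => \sum_(m <= j < n) f j s) =
    (fun s => \sum_(m <= j < n | (m <= j < n)%N) f j s).
  by apply/funext => s; rewrite big_nat.
apply: continuous_big => [|j]; [exact: add_continuous|exact: cf].
Qed.

Lemma within_continuous_enorm (A : set R) (p : R -> R * R) :
  {within A, continuous (fun s => (p s).1)} ->
  {within A, continuous (fun s => (p s).2)} ->
  {within A, continuous (fun s => enorm (p s))}.
Proof.
move=> c1 c2.
have cd : {within A, continuous (fun s => dot (p s) (p s))}.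
  move=> s; apply: cvgD; apply: cvgM; first [exact: c1 | exact: c2].
move=> s; have sq : Num.sqrt x @[x --> dot (p s) (p s)] --> enorm (p s).
  exact: sqrt_continuous.
exact: (cvg_comp _ _ (cd s) sq).
Qed.

End Calculus.

(** * Conservation and dissipation along a solution *)

Section Evolution.
Context {R : realType}.
Variables (N : nat) (sigma eta L0 : R) (X0 : R -> R * R).
Variables (X : R -> R -> R * R) (kappa : R -> R -> R).
Hypotheses (N_gt0 : (0 < N)%N) (eta_gt0 : 0 < eta).
Hypothesis solX : semidiscrete_solution N sigma eta L0 X0 X kappa.
Hypothesis nondegenerate : forall t : R, 0 <= t ->
  forall j, (1 <= j <= N)%N -> 0 < enorm (hvec N (X t) j).

Local Notation rho := (@rho R N).

(** The interpolation weights do not depend on time, so that the time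
derivative at a point of the cell is the interpolant of the nodal ones. *)
Lemma dt_lerp (f : R -> R -> R) (t : R) : 0 < t ->
  (forall s, 0 <= s -> in_Kh N (f s)) ->
  (forall i, (i <= N)%N -> derivable (f ^~ (rho i)) t 1) ->
  forall j, (1 <= j <= N)%N -> forall r, r \in `[rho j.-1, rho j] ->
  derive1 (f ^~ r) t = lerp N (fun i => derive1 (f ^~ (rho i)) t) j r.
Proof.
move=> t0 fK fd j jN r rj.
have Dn i : (i <= N)%N -> is_derive t 1 (f ^~ (rho i)) (derive1 (f ^~ (rho i)) t).
  by move=> /fd/derivableP; rewrite derive1E.
have [j0 leN] := andP jN.
have Dl := Dn _ (leq_trans (leq_pred j) leN).
have Dr := Dn _ leN.
have D := is_derive1D Dl (is_derive1Z ((r - rho j.-1) / mesh N) (is_derive1B Dr Dl)).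
rewrite derive1E -[RHS](@derive_val _ _ _ _ _ _ _ D).
apply: near_eq_derive; near=> s.
apply: (Kh_lerp N_gt0) => //; apply: fK.
by apply: ltW; near: s; exact: lt_nbhsr.
Unshelve. all: by end_near. Qed.

Lemma node_derive (t : R) (j : nat) : 0 < t -> (j <= N)%N ->
  is_derive t 1 (fun s => (X s (rho j)).1) (dt X t (rho j)).1 /\
  is_derive t 1 (fun s => (X s (rho j)).2) (dt X t (rho j)).2.
Proof.
move=> t0 jN; have [d1 d2] := sol_derivable solX (rho_in01 N_gt0 jN) t0.
by rewrite /dt/= !derive1E; split; apply/derivableP.
Qed.

Lemma dt_lerp1 (t : R) : 0 < t ->
  forall j, (1 <= j <= N)%N -> forall r, r \in `[rho j.-1, rho j] ->
  (dt X t r).1 = lerp N (fun i => (dt X t (rho i)).1) j r.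
Proof.
move=> t0; apply: (dt_lerp (f := fun s r => (X s r).1) t0).
- by move=> s s0; have [] := sol_Xh solX s0.
- by move=> i iN; have [[]] := node_derive t0 iN.
Qed.

Lemma dt_lerp2 (t : R) : 0 < t ->
  forall j, (1 <= j <= N)%N -> forall r, r \in `[rho j.-1, rho j] ->
  (dt X t r).2 = lerp N (fun i => (dt X t (rho i)).2) j r.
Proof.
move=> t0; apply: (dt_lerp (f := fun s r => (X s r).2) t0).
- by move=> s s0; have [_ []] := sol_Xh solX s0.
- by move=> i iN; have [_ []] := node_derive t0 iN.
Qed.

(** The velocity is an admissible test function [omega]: its second component
vanishes at both ends because that of the curve does at all times. *)
Lemma dt_Xh (t : R) : 0 < t -> in_Xh N (dt X t).
Proof.
move=> t0.
have dt0 r : (forall s, 0 <= s -> (X s r).2 = 0) -> (dt X t r).2 = 0.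
  move=> Xr; rewrite /dt/= derive1E (_ : 'D_1 _ t = 'D_1 (fun=> 0 : R) t).
    exact: derive_cst.
  apply: near_eq_derive; near=> s; apply: Xr.
  by apply: ltW; near: s; exact: lt_nbhsr.
split; first exact/(lerp_Kh N_gt0)/dt_lerp1.
split; first exact/(lerp_Kh N_gt0)/dt_lerp2.
- by apply: dt0 => s s0; have [_ []] := sol_Xh solX s0.
- by apply: dt0 => s s0; have [_ []] := sol_Xh solX s0.
Unshelve. all: by end_near. Qed.

Lemma is_derive_area (t : R) : 0 < t ->
  is_derive t 1 (fun s => area N (X s))
   (2^-1 * \sum_(1 <= j < N.+1)
     (((X t (rho j)).1 - (X t (rho j.-1)).1) *
        ((dt X t (rho j)).2 + (dt X t (rho j.-1)).2) +
      ((X t (rho j)).2 + (X t (rho j.-1)).2) *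
        ((dt X t (rho j)).1 - (dt X t (rho j.-1)).1))).
Proof.
move=> t0; apply: is_derive1Z; apply: is_derive1_sum => j; rewrite ltnS => /andP[j1 jN].
have [Dj1 Dj2] := node_derive t0 jN.
have [Di1 Di2] := node_derive t0 (leq_trans (leq_pred j) jN).
exact: is_derive1M (is_derive1B Dj1 Di1) (is_derive1D Dj2 Di2).
Qed.

(** The factor [|h_j|] of the lumped product cancels the normalization of the
normal. *)
Lemma lumped_normal_velocity (t : R) : 0 < t ->
  lumped N (X t) (fun r => dot (normal N (X t) r) (dt X t r)) (fun=> 1) =
  2^-1 * \sum_(1 <= j < N.+1)
    (((X t (rho j)).1 - (X t (rho j.-1)).1) *
        ((dt X t (rho j)).2 + (dt X t (rho j.-1)).2) -
     ((X t (rho j)).2 - (X t (rho j.-1)).2) *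
        ((dt X t (rho j)).1 + (dt X t (rho j.-1)).1)).
Proof.
move=> t0; pose V1 i := (dt X t (rho i)).1; pose V2 i := (dt X t (rho i)).2.
pose n j := - perp (tangent N (X t) j).
rewrite (@lumpedE _ _ N_gt0 _ _ _
  (fun j r => dot (n j) (lerp N V1 j r, lerp N V2 j r))); first last.
- move=> j jN r rj; rewrite mulr1 /normal (cell_itv N_gt0 _ rj); last by case/andP: jN.
  have rj' := subset_itv_oo_cc rj.
  by rewrite -(dt_lerp1 t0 jN rj') -(dt_lerp2 t0 jN rj').
- move=> j _ r; rewrite /dot/=.
  by apply: cvgD; apply: cvgM; (exact: cvg_cst || exact: lerp_continuous).
congr (_ * _); rewrite !big_nat; apply: eq_bigr => j; rewrite ltnS => jN.
have j0 : (0 < j)%N by case/andP: jN.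
rewrite !lerp_l !lerp_r// /n /tangent /V1 /V2 /dot/=.
have := lt0r_neq0 (nondegenerate (ltW t0) jN).
move: (enorm _) => e e0; rewrite /hvec/=.
by rewrite /GRing.scale/=; field.
Qed.

(** The test function [psi = 1] kills the stiffness term; what is left is the
derivative of the area up to a telescoping sum whose two end terms carry the
factors [y_0 = y_N = 0]. *)
Lemma area_derive0 (t : R) : 0 < t -> is_derive t 1 (fun s => area N (X s)) 0.
Proof.
move=> t0; have D := is_derive_area t0.
have [_ [_ y0 y1]] := sol_Xh solX (ltW t0).
have := sol_motion solX t0 (Kh_cst N_gt0 1).
rewrite lumped_normal_velocity// (_ : inner _ _ _ _ = 0) ?addr0; last first.
  rewrite /inner /arc_integral big1// => j _.
  rewrite (@eq_Rintegral _ _ _ _ _ (fun=> 0)); first by rewrite Rintegral_cst ?mul0r.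
  by move=> r _; rewrite /ds derive1_cst !(mulr0, mul0r).
(* The remaining claim is that area derivative and lumped product agree. *)
move=> V0; suff <- : 2^-1 * \sum_(1 <= j < N.+1)
     (((X t (rho j)).1 - (X t (rho j.-1)).1) *
        ((dt X t (rho j)).2 + (dt X t (rho j.-1)).2) +
      ((X t (rho j)).2 + (X t (rho j.-1)).2) *
        ((dt X t (rho j)).1 - (dt X t (rho j.-1)).1)) = 0 by [].
rewrite -[RHS]V0; congr (_ * _); apply/eqP; rewrite -subr_eq0 -sumrB big_add1/=.
pose f j := 2 * ((dt X t (rho j)).1 * (X t (rho j)).2).
rewrite (@telescope_sumr_eq _ _ _ f)// /f ?(rhoN N_gt0) ?rho0 ?y0 ?y1.
  by rewrite !mulr0 subrr.
by move=> k _; rewrite /dt/=; ring.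
Qed.

Lemma is_derive_energy (t : R) : 0 < t ->
  is_derive t 1 (fun s => energy N (X s) sigma)
    (innerv N (X t) (dsv N (X t) (X t)) (dsv N (X t) (dt X t))
     - sigma * ((dt X t 1).1 - (dt X t 0).1)).
Proof.
move=> t0.
rewrite (innerv_dsv N_gt0)//; last 3 first.
- exact/nondegenerate/ltW.
- exact/(sol_Xh solX)/ltW.
- exact: dt_Xh.
have [DN _] := node_derive t0 (leqnn N).
have [D0 _] := node_derive t0 (leq0n N).
apply: is_derive1B; last first.
  have -> : dt X t 1 = dt X t (rho N) by rewrite rhoN.
  have -> : dt X t 0 = dt X t (rho 0) by rewrite rho0.
  exact: is_derive1Z (is_derive1B DN D0).
apply: is_derive1_sum => j; rewrite ltnS => jN.
have [j1 leN] := andP jN.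
have [Dj1 Dj2] := node_derive t0 leN.
have [Di1 Di2] := node_derive t0 (leq_trans (leq_pred j) leN).
exact: (is_derive_enorm (p := fun s => hvec N (X s) j) (dp := hvec N (dt X t) j)
  (is_derive1B Dj1 Di1) (is_derive1B Dj2 Di2) (nondegenerate (ltW t0) jN)).
Qed.

(** The difference of the two equations of the scheme, tested with
[omega = dX/dt] and [psi = kappa]: their lumped products cancel. *)
Lemma dissipation (t : R) : 0 < t ->
  innerv N (X t) (dsv N (X t) (X t)) (dsv N (X t) (dt X t))
    - sigma * ((dt X t 1).1 - (dt X t 0).1) =
  - inner N (X t) (ds N (X t) (kappa t)) (ds N (X t) (kappa t))
  - 1 / eta * ((dt X t 0).1 ^+ 2 + (dt X t 1).1 ^+ 2).
Proof.
move=> t0.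
have := sol_motion solX t0 (sol_Kh solX t0).
have := sol_curvature solX t0 (dt_Xh t0).
have -> : derive1 (xcl N X) t = (dt X t 0).1 by rewrite /xcl rho0.
have -> : derive1 (xcr N X) t = (dt X t 1).1 by rewrite /xcr (rhoN N_gt0).
rewrite lumpedC -!expr2; lra.
Qed.

Lemma node_continuous (j : nat) : (j <= N)%N ->
  {within `[0, +oo[, continuous (fun s => (X s (rho j)).1)} /\
  {within `[0, +oo[, continuous (fun s => (X s (rho j)).2)}.
Proof. by move=> jN; exact/(sol_continuous solX)/rho_in01. Qed.

Lemma area_continuous : {within `[0, +oo[, continuous (fun s => area N (X s))}.
Proof.
move=> s; apply: cvgM; first exact: cvg_cst.
move: s; apply: within_continuous_sum => j.
rewrite ltnS => /andP[_ jN] s.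
have [cj1 cj2] := node_continuous jN.
have [ci1 ci2] := node_continuous (leq_trans (leq_pred j) jN).
by apply: cvgM; [apply: cvgB; [exact: cj1|exact: ci1]|
  apply: cvgD; [exact: cj2|exact: ci2]].
Qed.

Lemma energy_continuous :
  {within `[0, +oo[, continuous (fun s => energy N (X s) sigma)}.
Proof.
have [c0 _] := node_continuous (leq0n N); have [cN _] := node_continuous (leqnn N).
move=> s; apply: cvgB; last first.
  by apply: cvgM; [exact: cvg_cst|apply: cvgB; [exact: cN|exact: c0]].
move: s; apply: within_continuous_sum => j.
rewrite ltnS => /andP[_ jN].
have [cj1 cj2] := node_continuous jN.
have [ci1 ci2] := node_continuous (leq_trans (leq_pred j) jN).
apply: within_continuous_enorm => s.
- by apply: cvgB; [exact: cj1|exact: ci1].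
- by apply: cvgB; [exact: cj2|exact: ci2].
Qed.

Lemma area_constant (t : R) : 0 <= t -> area N (X t) = area N (X 0).
Proof.
move=> t0; have D (x : R) : x \in `]0, +oo[ -> is_derive x 1 (fun s => area N (X s)) 0.
  by rewrite in_itv/= andbT; exact: area_derive0.
have d (x : R) : x \in `]0, +oo[ -> derivable (fun s => area N (X s)) x 1.
  by move=> /D[].
have d0 (x : R) : x \in `]0, +oo[ -> derive1 (fun s => area N (X s)) x = 0.
  by move=> /D[_]; rewrite derive1E.
apply/eqP; rewrite eq_le; apply/andP; split.
- apply: (ler0_derive1_nincry d _ area_continuous (lexx 0) t0).
  by move=> x /d0 ->.
- apply: (ger0_derive1_ndecry d _ area_continuous (lexx 0) t0).
  by move=> x /d0 ->.
Qed.

Lemma energy_nonincreasing (t t' : R) : 0 <= t' -> t' <= t ->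
  energy N (X t) sigma <= energy N (X t') sigma.
Proof.
apply: (@ler0_derive1_nincry _ (fun s => energy N (X s) sigma)).
- by move=> x; rewrite in_itv/= andbT => /is_derive_energy[].
- move=> x; rewrite in_itv/= andbT => x0; have [_] := is_derive_energy x0.
  rewrite derive1E => ->; rewrite dissipation//.
  rewrite -opprD oppr_le0 addr_ge0 ?inner_ge0//.
  by rewrite mulr_ge0 ?addr_ge0 ?sqr_ge0// divr_ge0// ltW.
- exact: energy_continuous.
Qed.

End Evolution.

(** * Area conservation and energy decay *)

Theorem proposition3p1 (R : realType) (N : nat) (sigma eta L0 : R)
    (X0 : R -> R * R) (X : R -> R -> R * R) (kappa : R -> R -> R) :
  (1 <= N)%N -> -1 < sigma -> sigma < 1 -> 0 < eta ->
  arclength_param X0 L0 ->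
  (X0 0).2 = 0 -> (X0 L0).2 = 0 -> (X0 0).1 < (X0 L0).1 ->
  semidiscrete_solution N sigma eta L0 X0 X kappa ->
  (forall t : R, 0 <= t -> forall j, (1 <= j <= N)%N ->
     0 < enorm (hvec N (X t) j)) ->
  (forall t : R, 0 <= t -> xcl N X t <= xcr N X t) ->
  let s (j : nat) : R := j%:R * L0 / N%:R in
  let A0 : R := 2^-1 * \sum_(1 <= j < N.+1)
    ((X0 (s j)).1 - (X0 (s j.-1)).1) * ((X0 (s j)).2 + (X0 (s j.-1)).2) in
  [/\ (forall t : R, 0 <= t -> area N (X t) = area N (X 0)),
      area N (X 0) = A0,
      (0 < A0 -> forall t : R, 0 <= t -> 0 < area N (X t)),
      (forall t t' : R, 0 <= t' -> t' <= t ->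
         energy N (X t) sigma <= energy N (X t') sigma /\
         energy N (X t') sigma <= energy N (X 0) sigma)
    & energy N (X 0) sigma =
        \sum_(1 <= j < N.+1) enorm (hvec N (X 0) j)
        - sigma * (xcr N X 0 - xcl N X 0)].
Proof.
move=> N_gt0 _ _ eta_gt0 _ _ _ _ sol nondeg _ s A0.
have A0E : area N (X 0) = A0.
  rewrite /area /A0 !big_nat; congr (_ * _); apply: eq_bigr => j.
  rewrite ltnS => /andP[_ jN].
  by rewrite !(sol_init sol)// (leq_trans (leq_pred j)).
have areaE := area_constant N_gt0 sol nondeg.
have energy_le := energy_nonincreasing N_gt0 eta_gt0 sol nondeg.
split => //.
- by move=> A0_gt0 t t0; rewrite areaE// A0E.
- by move=> t t' t'0 t't; split; apply: energy_le.
Qed.
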